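(* The real Lie algebra $\mathbf g=\mathfrak{sl}_2(\mathbb C)$ is reductive with respect to the following pairs $(\mathbf h,\mathbf m)$, where $\mathbf h$ is an at most $2$-dimensional subalgebra of $\mathbf g$ and $\mathbf m$ is a complementary subspace to $\mathbf h$ generating $\mathbf g$: 1) $\mathbf h_3=\langle e_3,\mathrm i e_3\rangle$, $\mathbf m=\langle e_1,e_2,\mathrm i e_1,\mathrm i e_2\rangle$; 2) $\mathbf h_4=\langle e_1\rangle$, $\mathbf m_a=\langle e_2,e_3,\mathrm i e_1+a e_1,\mathrm i e_2,\mathrm i e_3\rangle$, where $a\in\mathbb R$; 3) $\mathbf h_6=\langle e_3\rangle$, $\mathbf m_b=\langle e_1,e_2,\mathrm i e_1,\mathrm i e_2,\mathrm i e_3+b e_3\rangle$, where $b\in\mathbb R$.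
   Context: $\mathfrak{sl}_2(\mathbb C)$ is regarded as a $6$-dimensional real Lie algebra with real basis $e_1,e_2,e_3,\mathrm i e_1,\mathrm i e_2,\mathrm i e_3$, where $\mathrm i^2=-1$ and $$e_1=\begin{pmatrix}1&0\\0&-1\end{pmatrix},\quad e_2=\begin{pmatrix}0&1\\1&0\end{pmatrix},\quad e_3=\begin{pmatrix}0&1\\-1&0\end{pmatrix}.$$ $\langle\cdots\rangle$ denotes the real linear span. $\mathbf g$ is reductive with respect to $(\mathbf h,\mathbf m)$ if $\mathbf h$ is a subalgebra, $\mathbf m$ is a subspace, $\mathbf g=\mathbf m\oplus\mathbf h$ as vector spaces and $[\mathbf h,\mathbf m]\subseteq\mathbf m$. ''$\mathbf m$ generates $\mathbf g$'' means generation as a Lie algebra. *)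

(* Defs.v *)
From HB Require Import structures.
From mathcomp Require Import all_boot all_order all_algebra.
From mathcomp Require Import complex.
From mathcomp Require Import ring.

Set Implicit Arguments.
Unset Strict Implicit.
Unset Printing Implicit Defensive.

Import Order.TTheory GRing.Theory Num.Theory.
Local Open Scope ring_scope.

HB.mixin Record Vector_isLieAlgebra (F : fieldType) V of Vector F V := {
  lie : V -> V -> V;
  lie_linearl : forall y, linear (fun x => lie x y);
  lie_linearr : forall x, linear (lie x);
  liexx : forall x, lie x x = 0;
  lie_jacobi : forall x y z,
    lie x (lie y z) + lie y (lie z x) + lie z (lie x y) = 0 }.

#[short(type="lieAlgType")]
HB.structure Definition LieAlgebra (F : fieldType) :=
  { V of Vector_isLieAlgebra F V & Vector F V }.

Section LieAlgebraNotions.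
Variables (F : fieldType) (g : lieAlgType F).
Implicit Types h m k : {vspace g}.

Definition lie_subalgebra h : Prop :=
  forall x y, x \in h -> y \in h -> lie x y \in h.

Definition complementary h m : Prop :=
  (m + h)%VS = fullv /\ (m :&: h)%VS = 0%VS.

Definition reductive_wrt h m : Prop :=
  [/\ lie_subalgebra h, complementary h m &
      forall x y, x \in h -> y \in m -> lie x y \in m].

Definition generated_subalgebra m k : Prop :=
  [/\ lie_subalgebra k, (m <= k)%VS &
      forall k', lie_subalgebra k' -> (m <= k')%VS -> (k <= k')%VS].

Definition lie_generates m : Prop := generated_subalgebra m fullv.

End LieAlgebraNotions.

Section Sl2.
Variable R : rcfType.
Local Notation C := R[i].

Definition traceless : {pred 'M[C]_2} := fun A => \tr A == 0.

Fact traceless_zmod_closed : zmod_closed traceless.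
Proof.
split=> [|A B]; first by rewrite unfold_in mxtrace0.
by rewrite !unfold_in raddfB /= => /eqP-> /eqP->; rewrite subrr.
Qed.
HB.instance Definition _ :=
  GRing.isZmodClosed.Build 'M[C]_2 traceless traceless_zmod_closed.

Record sl2C := Sl2C { sl2C_mx :> 'M[C]_2; sl2C_mxP : sl2C_mx \in traceless }.
HB.instance Definition _ := [isSub for sl2C_mx].
HB.instance Definition _ := [Choice of sl2C by <:].
HB.instance Definition _ := [SubChoice_isSubZmodule of sl2C by <:].

Fact sl2C_scale_subproof (c : C) (x : sl2C) : c *: sl2C_mx x \in traceless.
Proof. by rewrite unfold_in mxtraceZ (eqP (sl2C_mxP x)) mulr0. Qed.
Definition sl2C_scale (c : C) (x : sl2C) := Sl2C (sl2C_scale_subproof c x).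

(* sl2C carries two scalar actions; only the real one, by restriction of
   scalars along R -> R[i], is registered as its module structure. *)
Definition sl2C_rscale (a : R) : sl2C -> sl2C := sl2C_scale a%:C%C.

Fact sl2C_rscaleA a b v :
  sl2C_rscale a (sl2C_rscale b v) = sl2C_rscale (a * b) v.
Proof. by apply: val_inj; rewrite /= scalerA -rmorphM. Qed.
Fact sl2C_rscale1 : left_id 1 sl2C_rscale.
Proof. by move=> v; apply: val_inj; rewrite /= rmorph1 scale1r. Qed.
Fact sl2C_rscaleDr : right_distributive sl2C_rscale +%R.
Proof. by move=> a u v; apply: val_inj; rewrite /= scalerDr. Qed.
Fact sl2C_rscaleDl v : {morph sl2C_rscale^~ v : a b / a + b}.
Proof. by move=> a b; apply: val_inj; rewrite /= rmorphD scalerDl. Qed.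
HB.instance Definition _ := GRing.Zmodule_isLmodule.Build R sl2C
  sl2C_rscaleA sl2C_rscale1 sl2C_rscaleDr sl2C_rscaleDl.

Definition mx2 (a b c d : C) : 'M[C]_2 :=
  \matrix_(i, j) if i == 0 then (if j == 0 then a else b)
                 else (if j == 0 then c else d).

Fact mx2_traceless a b c : mx2 a b c (- a) \in traceless.
Proof.
rewrite unfold_in /mxtrace !big_ord_recr big_ord0 /= !mxE /=.
by rewrite add0r subrr.
Qed.

(* The matrix with rows (a, b) and (c, - a). *)
Definition sl2C_of (a b c : C) : sl2C := Sl2C (mx2_traceless a b c).

Lemma sl2C_ofK (x : sl2C) :
  sl2C_of (sl2C_mx x 0 0) (sl2C_mx x 0 1) (sl2C_mx x 1 0) = x.
Proof.
apply: val_inj => /=; case: x => A /=; rewrite unfold_in /mxtrace.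
rewrite !big_ord_recr big_ord0 /= add0r.
set i0 := widen_ord _ _; have ->: i0 = 0 by apply: val_inj.
have ->: ord_max = 1 :> 'I_2 by apply: val_inj.
rewrite addr_eq0 => /eqP e; apply/matrixP => i j; rewrite !mxE.
have [->|ni] := eqVneq i 0; have [->|nj] := eqVneq j 0 => //.
- by congr (A _ _); apply: val_inj; case: j nj => [[|[|]]].
- by congr (A _ _); apply: val_inj; case: i ni => [[|[|]]].
rewrite e opprK; congr (A _ _); apply: val_inj.
  by case: i ni => [[|[|]]].
by case: j nj => [[|[|]]].
Qed.

Fact sl2C_vect_iso : Vector.axiom 6 sl2C.
Proof.
pose f (x : sl2C) : 'rV[R]_6 := \row_i nth 0
  [:: complex.Re (sl2C_mx x 0 0); complex.Im (sl2C_mx x 0 0);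
      complex.Re (sl2C_mx x 0 1); complex.Im (sl2C_mx x 0 1);
      complex.Re (sl2C_mx x 1 0); complex.Im (sl2C_mx x 1 0)] i.
exists f.
  move=> a x y; apply/rowP => i.
  have E j k : sl2C_mx (a *: x + y) j k
      = a%:C%C * sl2C_mx x j k + sl2C_mx y j k by rewrite !mxE.
  rewrite [LHS]mxE !E !mxE.
  case: (sl2C_mx x 0 0) (sl2C_mx x 0 1) (sl2C_mx x 1 0) => ? ? [? ?] [? ?].
  case: (sl2C_mx y 0 0) (sl2C_mx y 0 1) (sl2C_mx y 1 0) => ? ? [? ?] [? ?].
  by case: i => [[|[|[|[|[|[|//]]]]]]] i6 /=; rewrite ?mul0r ?subr0 ?addr0.
pose o k := inord k : 'I_6.
exists (fun r : 'rV[R]_6 => sl2C_of (r 0 (o 0%N) +i* r 0 (o 1%N))%C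
   (r 0 (o 2%N) +i* r 0 (o 3%N))%C (r 0 (o 4%N) +i* r 0 (o 5%N))%C).
  move=> x; rewrite -[RHS]sl2C_ofK /f !mxE !inordK //=.
  by case: (sl2C_mx x 0 0) (sl2C_mx x 0 1) (sl2C_mx x 1 0) => ? ? [? ?] [? ?].
move=> r; apply/rowP => i; rewrite !mxE /=.
by case: i => [[|[|[|[|[|[|//]]]]]]] i6 /=; congr (r _ _); apply: val_inj;
  rewrite /= inordK.
Qed.
HB.instance Definition _ := Lmodule_hasFinDim.Build R sl2C sl2C_vect_iso.

Fact sl2C_lie_subproof (x y : sl2C) :
  sl2C_mx x *m sl2C_mx y - sl2C_mx y *m sl2C_mx x \in traceless.
Proof. by rewrite unfold_in raddfB /= mxtrace_mulC subrr. Qed.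
Definition sl2C_lie (x y : sl2C) : sl2C := Sl2C (sl2C_lie_subproof x y).

Fact sl2C_lie_linearl y : linear (fun x => sl2C_lie x y).
Proof.
move=> a u v; apply: val_inj => /=.
by rewrite mulmxDl mulmxDr -scalemxAl -scalemxAr scalerBr opprD addrACA.
Qed.
Fact sl2C_lie_linearr x : linear (sl2C_lie x).
Proof.
move=> a u v; apply: val_inj => /=.
by rewrite mulmxDl mulmxDr -scalemxAl -scalemxAr scalerBr opprD addrACA.
Qed.
Fact sl2C_liexx x : sl2C_lie x x = 0.
Proof. by apply: val_inj => /=; rewrite subrr. Qed.
Fact sl2C_lie_jacobi x y z :
  sl2C_lie x (sl2C_lie y z) + sl2C_lie y (sl2C_lie z x)
  + sl2C_lie z (sl2C_lie x y) = 0.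
Proof.
apply: val_inj; case: x y z => [A _] [B _] [D _] /=.
rewrite !mulmxBr !mulmxBl !mulmxA.
move: (A *m B *m D) (A *m D *m B) (B *m A *m D) => P1 P2 P3.
move: (B *m D *m A) (D *m A *m B) (D *m B *m A) => P4 P5 P6.
by apply/matrixP => i j; rewrite !mxE; ring.
Qed.
HB.instance Definition _ := Vector_isLieAlgebra.Build R sl2C
  sl2C_lie_linearl sl2C_lie_linearr sl2C_liexx sl2C_lie_jacobi.

Definition e1 : sl2C := sl2C_of 1 0 0.
Definition e2 : sl2C := sl2C_of 0 1 1.
Definition e3 : sl2C := sl2C_of 0 1 (-1).
(* Multiplication by the imaginary unit. *)
Definition imul (x : sl2C) : sl2C := sl2C_scale 'i%C x.

End Sl2.

(* Main.v *)
Require Import Defs.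
From HB Require Import structures.
From mathcomp Require Import all_boot all_order all_algebra.
From mathcomp Require Import reals.
From mathcomp Require Import complex.
From mathcomp Require Import ring.
Import Order.TTheory GRing.Theory Num.Theory.
Local Open Scope ring_scope.

(** Everything follows from the bracket table
    [e1, e2] = 2 e3, [e1, e3] = 2 e2, [e2, e3] = - 2 e1
    and from the bracket being C-bilinear, which gives the brackets involving
    i e1, i e2, i e3.

    Reductivity is a condition on spans of lists of vectors, so closure under
    brackets needs only be read off the table on the given spanning vectors
    (lie_span).  The parameters a and b do no harm because the vector that
    carries one, i e1 + a e1 or i e3 + b e3, commutes with the generator of the
    isotropy algebra.  In each case the vectors spanning m and h together span
    the whole algebra (sl2C_full) and there are at most six of them, so
    counting dimensions makes the sum direct (reductive_span).

    For generation, a subalgebra containing e1, e2 and i e2 contains e3, then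
    i e1 and i e3, hence is everything (sl2C_gen).  Those three vectors lie in m
    in the first and last families; in the middle one m contains e2, e3 and
    i e2, and e1 is recovered from [e2, e3]. *)

Section LieSpans.
Context {F : fieldType} {g : lieAlgType F}.
Implicit Types (x y : g) (X Y : seq g) (m k U : {vspace g}).

HB.instance Definition _ x :=
  GRing.isLinear.Build F g g *:%R (lie x) (lie_linearr x).

Lemma lieC x y : lie x y = - lie y x.
Proof.
have lieDl z : lie (x + y) z = lie x z + lie y z.
  by have := lie_linearl z 1 x y; rewrite !scale1r.
have := liexx (x + y).
by rewrite lieDl !linearD /= !liexx add0r addr0 => /eqP; rewrite addr_eq0 => /eqP.
Qed.

(** The vectors whose bracket with a fixed x lies in U form the preimage of U
    under a linear map, so they contain a span as soon as they contain its
    generators; antisymmetry transfers this to the other argument. *)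
Lemma lie_span X Y U : allrel (fun x y => lie x y \in U) X Y ->
  forall x y, x \in <<X>>%VS -> y \in <<Y>>%VS -> lie x y \in U.
Proof.
have span_r (Z : seq g) x : {in Z, forall z, lie x z \in U} ->
    forall z, z \in <<Z>>%VS -> lie x z \in U.
  move=> xZU; suff /subvP sub : (<<Z>> <= linfun (lie x) @^-1: U)%VS.
    by move=> z /sub; rewrite -memv_preim lfunE.
  by apply/span_subvP => z Zz; rewrite -memv_preim lfunE; apply: xZU.
move=> /allrelP XYU x y Xx Yy; rewrite lieC memvN.
apply: (span_r X) Xx => z Xz; rewrite lieC memvN.
by apply: (span_r Y) Yy => t; apply: XYU.
Qed.

(** The bound on the number of vectors replaces any check that the two spans
    meet trivially: by the dimension formula, a spanning list with at most
    dim g entries leaves no room for an intersection. *)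
Lemma reductive_span X Y :
  allrel (fun x y => lie x y \in <<X>>%VS) X X ->
  allrel (fun x y => lie x y \in <<Y>>%VS) X Y ->
  <<Y ++ X>>%VS = fullv -> (size Y + size X <= dim g)%N ->
  reductive_wrt <<X>>%VS <<Y>>%VS.
Proof.
move=> XX XY full size_le; rewrite span_cat in full.
split; [exact: lie_span | split=> // | exact: lie_span].
apply/eqP; rewrite -dimv_eq0 -leqn0 -(leq_add2l (\dim {:g})) addn0 {2}dimvf.
by rewrite -{1}full dimv_sum_cap (leq_trans _ size_le) // leq_add ?dim_span.
Qed.

Lemma lie_generates_closure m :
  (forall k, lie_subalgebra k -> (m <= k)%VS -> k = fullv) -> lie_generates m.
Proof.
move=> closure_full; split=> [x y _ _||k k_alg mk]; [exact: memvf|exact: subvf|].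
by rewrite (closure_full k).
Qed.

End LieSpans.

Ltac sl2C_entries :=
  apply: val_inj; apply/matrixP => - [[|[|//]] ?] [[|[|//]] ?];
  rewrite ?mulr2n /= !mxE ?big_ord_recr ?big_ord0 /= ?mxE /=.

Section Sl2Brackets.
Context {R : rcfType}.
Implicit Types (x y z : sl2C R) (k U : {vspace sl2C R}).
Local Notation e1 := (e1 R).
Local Notation e2 := (e2 R).
Local Notation e3 := (e3 R).

Fact imul_linear : linear (@imul R).
Proof.
move=> a x y; apply: val_inj.
by rewrite /= scalerDr !scalerA [a%:C%C * _]mulrC.
Qed.
HB.instance Definition _ :=
  GRing.isLinear.Build R (sl2C R) (sl2C R) *:%R (@imul R) imul_linear.

(** The generic additivity lemmas would also match x *+ n, which is additive in
   x, when rewriting; these instances fix the map. *)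
Lemma imulN x : imul (- x) = - imul x. Proof. exact: linearN. Qed.

Lemma imulMn x n : imul (x *+ n) = imul x *+ n. Proof. exact: linearMn. Qed.

Lemma imul0 : imul 0 = 0 :> sl2C R. Proof. exact: linear0. Qed.

Lemma imulK x : imul (imul x) = - x.
Proof. by apply: val_inj; rewrite /= scalerA -expr2 sqr_i scaleN1r. Qed.

Lemma lie_imull x y : lie (imul x) y = imul (lie x y).
Proof. by apply: val_inj; rewrite /= -scalemxAl -scalemxAr -scalerBr. Qed.

Lemma lie_imulr x y : lie x (imul y) = imul (lie x y).
Proof. by apply: val_inj; rewrite /= -scalemxAl -scalemxAr -scalerBr. Qed.

Lemma lie_e1e2 : lie e1 e2 = e3 *+ 2.
Proof. by sl2C_entries; ring. Qed.

Lemma lie_e1e3 : lie e1 e3 = e2 *+ 2.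
Proof. by sl2C_entries; ring. Qed.

Lemma lie_e2e3 : lie e2 e3 = - e1 *+ 2.
Proof. by sl2C_entries; ring. Qed.

(** Antisymmetry enters only at the three pairs that need reordering: the
    general rule would make repeated rewriting loop. *)
Definition lie_sl2C := (lie_imull, lie_imulr, lieC e2 e1, lieC e3 e1, lieC e3 e2,
  lie_e1e2, lie_e1e3, lie_e2e3, @liexx R (sl2C R)).

(** The matrix with rows (a, b) and (c, - a) is
    a e1 + (b + c)/2 e2 + (b - c)/2 e3, and a complex multiple of a vector y
    is a real combination of y and i y. *)
Lemma sl2C_full U :
  e1 \in U -> e2 \in U -> e3 \in U ->
  imul e1 \in U -> imul e2 \in U -> imul e3 \in U -> U = fullv.
Proof.
move=> Ue1 Ue2 Ue3 Uf1 Uf2 Uf3; apply/vspaceP => x; rewrite memvf.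
have Umul y (c : R[i]) : y \in U -> imul y \in U -> sl2C_scale c y \in U.
  move=> Uy Ufy.
  suff -> : sl2C_scale c y = complex.Re c *: y + complex.Im c *: imul y.
    by rewrite memvD ?memvZ.
  by apply: val_inj; rewrite /= scalerA -scalerDl {1}[c]complexE mulrC.
pose a := sl2C_mx x 0 0; pose b := sl2C_mx x 0 1; pose c := sl2C_mx x 1 0.
suff -> : x = sl2C_scale a e1 + sl2C_scale ((b + c) / 2) e2
              + sl2C_scale ((b - c) / 2) e3.
  by apply: memvD; [apply: memvD|]; apply: Umul.
rewrite -[LHS]sl2C_ofK -/a -/b -/c; move: a b c => a b c.
by sl2C_entries; field.
Qed.

Lemma lie_sl2C_mem k x y z : lie_subalgebra k ->
  lie x y = z *+ 2 -> x \in k -> y \in k -> z \in k.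
Proof.
move=> k_alg xyE kx ky; have -> : z = 2^-1 *: lie x y.
  by rewrite xyE -scaler_nat scalerA mulVf ?scale1r ?pnatr_eq0.
by rewrite memvZ // k_alg.
Qed.

(** The missing basis vectors are e3 = [e1, e2]/2, i e1 = - [i e2, e3]/2 and
    i e3 = [e1, i e2]/2. *)
Lemma sl2C_gen k : lie_subalgebra k ->
  e1 \in k -> e2 \in k -> imul e2 \in k -> k = fullv.
Proof.
move=> k_alg k1 k2 kf2; have mem := lie_sl2C_mem _ _ _ _ k_alg.
have k3 : e3 \in k by apply: mem lie_e1e2 k1 k2.
apply: sl2C_full => //.
  rewrite -memvN -imulN; apply: mem _ kf2 k3.
  by rewrite lie_imull lie_e2e3 imulMn.
by apply: mem _ k1 kf2; rewrite lie_imulr lie_e1e2 imulMn.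
Qed.

End Sl2Brackets.

Ltac in_span := by apply: memv_span; rewrite /= !inE eqxx ?orbT.

(** In all three families, the bracket table turns each bracket of a spanning
    vector of h with one of h or m into 0 or, up to sign, into twice a spanning
    vector. *)
Ltac brackets_in_span :=
  rewrite /allrel /= ?linearD ?linearZ /= !lie_sl2C;
  rewrite ?(imulK, imulN, imulMn, imul0) ?scaler0 ?addr0;
  repeat (apply/andP; split); rewrite ?memvN ?mem0v //;
  apply: rpredMn; rewrite ?memvN; in_span.

Theorem proposition4 (R : realType) :
  let e1 : sl2C R := e1 R in
  let e2 : sl2C R := e2 R in
  let e3 : sl2C R := e3 R in
  let h3 : {vspace sl2C R} := <<[:: e3; imul e3]>>%VS in
  let m3 : {vspace sl2C R} := <<[:: e1; e2; imul e1; imul e2]>>%VS in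
  let h4 : {vspace sl2C R} := <<[:: e1]>>%VS in
  let m4 (a : R) : {vspace sl2C R} :=
    <<[:: e2; e3; (imul e1 + a *: e1)%R; imul e2; imul e3]>>%VS in
  let h6 : {vspace sl2C R} := <<[:: e3]>>%VS in
  let m6 (b : R) : {vspace sl2C R} :=
    <<[:: e1; e2; imul e1; imul e2; (imul e3 + b *: e3)%R]>>%VS in
  [/\ [/\ (\dim h3 <= 2)%N, reductive_wrt h3 m3 & lie_generates m3],
      forall a : R,
        [/\ (\dim h4 <= 2)%N, reductive_wrt h4 (m4 a) & lie_generates (m4 a)]
    & forall b : R,
        [/\ (\dim h6 <= 2)%N, reductive_wrt h6 (m6 b) & lie_generates (m6 b)]].
Proof.
cbv zeta; split; [|move=> a|move=> b]; split.
- exact: dim_span.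
- apply: reductive_span; [by brackets_in_span | by brackets_in_span | | by []].
  by apply: sl2C_full; in_span.
- apply: lie_generates_closure => k k_alg /span_subvP mk.
  by apply: sl2C_gen => //; apply: mk; rewrite !inE eqxx ?orbT.
- by rewrite (leq_trans (dim_span _)).
- apply: reductive_span; [by brackets_in_span | by brackets_in_span | | by []].
  apply: sl2C_full; try in_span.
  (* i e1 is the difference of i e1 + a e1 in m and a e1 in h. *)
  by rewrite -{1}[imul _](addrK (a *: e1 R)); apply: memvB; [|apply: memvZ]; in_span.
- apply: lie_generates_closure => k k_alg /span_subvP mk.
  have [k2 k3 kf2] : [/\ e2 R \in k, e3 R \in k & imul (e2 R) \in k].
    by split; apply: mk; rewrite !inE eqxx ?orbT.
  apply: sl2C_gen => //; rewrite -memvN.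
  exact: lie_sl2C_mem k_alg lie_e2e3 k2 k3.
- by rewrite (leq_trans (dim_span _)).
- apply: reductive_span; [by brackets_in_span | by brackets_in_span | | by []].
  apply: sl2C_full; try in_span.
  (* i e3 is the difference of i e3 + b e3 in m and b e3 in h. *)
  by rewrite -{1}[imul _](addrK (b *: e3 R)); apply: memvB; [|apply: memvZ]; in_span.
- apply: lie_generates_closure => k k_alg /span_subvP mk.
  by apply: sl2C_gen => //; apply: mk; rewrite !inE eqxx ?orbT.
Qed.
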